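(* Let $k$ be an algebraically closed field, $d \geqslant 1$ an integer, $A$ a finite dimensional $k$-algebra, and $\mathscr{M} \subseteq \operatorname{mod} A$ a $d$-cluster tilting subcategory. Assume that $\mathscr{M}$ has no cycles and that it has only finitely many isomorphism classes of indecomposable modules. Then the elements of the spine of the lattice of $d$-torsion classes of $\mathscr{M}$ are precisely the splitting $d$-torsion classes of $\mathscr{M}$.
   Context: $\operatorname{mod} A$ is the abelian category of finite dimensional right $A$-modules. An additive subcategory means a full subcategory closed under isomorphisms, finite direct sums and direct summands. A $d$-cluster tilting subcategory $\mathscr{M} \subseteq \operatorname{mod} A$ is a functorially finite additive subcategory such that $$\mathscr{M} = \{X \in \operatorname{mod} A \mid \operatorname{Ext}^i_A(X,\mathscr{M}) = 0 \text{ for } 0<i<d\} = \{X \in \operatorname{mod} A \mid \operatorname{Ext}^i_A(\mathscr{M},X) = 0 \text{ for } 0<i<d\}.$$ A cycle in $\mathscr{M}$ is a sequence of homomorphisms $M \xrightarrow{\mu_0} M_1 \xrightarrow{\mu_1} \cdots \xrightarrow{\mu_{t-2}} M_{t-1} \xrightarrow{\mu_{t-1}} M$ with $t \geqslant 1$, where $M$ and each $M_i$ is indecomposable in $\mathscr{M}$, and each $\mu_i$ is not zero and not an isomorphism (for $t=1$ it has the form $M \xrightarrow{\mu_0} M$). A $d$-exact sequence in $\mathscr{M}$ is an exact sequence $0 \to M^0 \to M^1 \to \cdots \to M^d \to M^{d+1} \to 0$ in $\operatorname{mod} A$ with each $M^i \in \mathscr{M}$. Let $\mathscr{U} \subseteq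 \mathscr{M}$ be an additive subcategory. A canonical $d$-exact sequence of $M \in \mathscr{M}$ with respect to $\mathscr{U}$ is a $d$-exact sequence $0 \to U \xrightarrow{\upsilon} M \to V^1 \to \cdots \to V^d \to 0$ in $\mathscr{M}$ with $U \in \mathscr{U}$ such that $0 \to \operatorname{Hom}_A(\widetilde{U},V^1) \to \cdots \to \operatorname{Hom}_A(\widetilde{U},V^d) \to 0$ is exact for each $\widetilde{U} \in \mathscr{U}$. A $d$-torsion class $\mathscr{U} \subseteq \mathscr{M}$ is an additive subcategory such that each $M \in \mathscr{M}$ has a canonical $d$-exact sequence with respect to $\mathscr{U}$. It is called splitting if each $M \in \mathscr{M}$ has a canonical $d$-exact sequence with respect to $\mathscr{U}$ in which $\upsilon$ is a split monomorphism. The set of $d$-torsion classes of $\mathscr{M}$, partially ordered by inclusion, is a lattice (known; meets are given by intersection). The spine of a lattice consists of the elements which belong to a chain of maximal length, i.e. a chain whose length is maximal among the lengths of all chains in the lattice; the length of a chain $x_0 < x_1 < \cdots < x_m$ is $m$. *)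

(* Defs.v *)
From HB Require Import structures.
From mathcomp Require Import all_boot all_order all_algebra all_field.

Set Implicit Arguments.
Unset Strict Implicit.
Unset Printing Implicit Defensive.

Import GRing.Theory.
Local Open Scope ring_scope.

(* Finite dimensional right A-modules.  Linearity in the algebra argument makes
   the k-structure of M the one induced by k -> A. *)
Record fdmod (k : fieldType) (A : falgType k) := FDMod {
  fdmod_sort :> vectType k;
  act : fdmod_sort -> A -> fdmod_sort;
  act_linearl : forall a : A, linear (act^~ a);
  act_linearr : forall v : fdmod_sort, linear (act v);
  act1 : forall v : fdmod_sort, act v 1 = v;
  actM : forall (v : fdmod_sort) (a b : A), act v (a * b) = act (act v a) b }.

Section ModuleCategory.
Variables (k : fieldType) (A : falgType k).
Local Notation modA := (fdmod A).

Record homA (M N : modA) := HomA {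
  homA_val :> 'Hom(M, N);
  homA_act : forall (v : M) (a : A), homA_val (act v a) = act (homA_val v) a }.

Definition is_zero (M : modA) : Prop := \dim {: M} = 0%N.

Definition is_iso (M N : modA) (f : homA M N) : Prop :=
  exists g : homA N M, (g \o f)%VF = \1%VF /\ (f \o g)%VF = \1%VF.

Definition isomorphic (M N : modA) : Prop := exists f : homA M N, is_iso f.

Definition split_mono (M N : modA) (f : homA M N) : Prop :=
  exists g : homA N M, (g \o f)%VF = \1%VF.

Section DirectSum.
Variables M N : modA.

Definition dsum_act (v : (M * N)%type) (a : A) : (M * N)%type :=
  (act v.1 a, act v.2 a).

Fact dsum_act_linearl a : linear (dsum_act^~ a).
Proof. by move=> c u v; rewrite /dsum_act !act_linearl. Qed.

Fact dsum_act_linearr v : linear (dsum_act v).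
Proof. by move=> c a b; rewrite /dsum_act !act_linearr. Qed.

Fact dsum_act1 v : dsum_act v 1 = v.
Proof. by case: v => x y; rewrite /dsum_act !act1. Qed.

Fact dsum_actM v a b : dsum_act v (a * b) = dsum_act (dsum_act v a) b.
Proof. by rewrite /dsum_act !actM. Qed.

Definition dsum : modA :=
  FDMod dsum_act_linearl dsum_act_linearr dsum_act1 dsum_actM.

End DirectSum.

Definition indecomposable (M : modA) : Prop :=
  ~ is_zero M /\
  forall X Y : modA, isomorphic M (dsum X Y) -> is_zero X \/ is_zero Y.

(* Full subcategories of mod A are given by their classes of objects.  The
   second clause is closure under empty direct sums. *)
Definition additive_subcategory (C : modA -> Prop) : Prop :=
  [/\ forall X Y, isomorphic X Y -> C X -> C Y,
      forall X, is_zero X -> C X,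
      forall X Y, C X -> C Y -> C (dsum X Y)
    & forall X Y, C (dsum X Y) -> C X /\ C Y].

Definition contravariantly_finite (C : modA -> Prop) : Prop :=
  forall X : modA, exists M (f : homA M X), C M /\
    forall M' (g : homA M' X), C M' ->
      exists h : homA M' M, homA_val g = (f \o h)%VF.

Definition covariantly_finite (C : modA -> Prop) : Prop :=
  forall X : modA, exists M (f : homA X M), C M /\
    forall M' (g : homA X M'), C M' ->
      exists h : homA M M', homA_val g = (h \o f)%VF.

Definition functorially_finite (C : modA -> Prop) : Prop :=
  contravariantly_finite C /\ covariantly_finite C.

Definition projective (P : modA) : Prop :=
  forall (Y Z : modA) (g : homA Y Z) (f : homA P Z), limg g = fullv ->
    exists h : homA P Y, homA_val f = (g \o h)%VF.

Record proj_resolution (X : modA) := ProjResolution {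
  res_obj :> nat -> modA;
  res_diff : forall i, homA (res_obj i.+1) (res_obj i);
  res_aug : homA (res_obj 0%N) X;
  res_proj : forall i, projective (res_obj i);
  res_aug_surj : limg res_aug = fullv;
  res_exact0 : limg (res_diff 0%N) = lker res_aug;
  res_exact : forall i, limg (res_diff i.+1) = lker (res_diff i) }.

Definition coboundary (X Y : modA) (P : proj_resolution X) (i : nat) :
    homA (P i) Y -> Prop :=
  match i with
  | 0%N => fun f => homA_val f = 0
  | j.+1 => fun f =>
      exists g : homA (P j) Y, homA_val f = (g \o res_diff P j)%VF
  end.

(* Ext^i_A(X, Y) = 0, i.e. H^i(Hom_A(P, Y)) = 0 for P a projective resolution
   of X; every X has one in mod A since A is finite dimensional, and the
   cohomology does not depend on it up to isomorphism. *)
Definition Ext_zero (i : nat) (X Y : modA) : Prop :=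
  forall (P : proj_resolution X) (f : homA (P i) Y),
    (f \o res_diff P i)%VF = 0 -> coboundary f.

Definition cluster_tilting (d : nat) (C : modA -> Prop) : Prop :=
  [/\ additive_subcategory C,
      functorially_finite C,
      forall X, C X <->
        forall i Y, (0 < i < d)%N -> C Y -> Ext_zero i X Y
    & forall X, C X <->
        forall i Y, (0 < i < d)%N -> C Y -> Ext_zero i Y X].

(* The objects of a cycle are indexed by Z/t: ordS is the cyclic successor. *)
Definition has_cycle (C : modA -> Prop) : Prop :=
  exists t (M : 'I_t -> modA) (mu : forall i, homA (M i) (M (ordS i))),
    (0 < t)%N /\
    forall i, [/\ C (M i), indecomposable (M i),
                  homA_val (mu i) <> 0 & ~ is_iso (mu i)].

Definition finitely_many_indecomposables (C : modA -> Prop) : Prop :=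
  exists n (N : 'I_n -> modA),
    forall X, C X -> indecomposable X -> exists i, isomorphic X (N i).

(* The exact sequence 0 -> E 0 -> E 1 -> ... -> E d.+1 -> 0 in C; the trailing
   zero is E d.+2, and the later terms are irrelevant. *)
Definition d_exact (d : nat) (C : modA -> Prop) (E : nat -> modA)
    (delta : forall i, homA (E i) (E i.+1)) : Prop :=
  [/\ forall i, (i <= d.+1)%N -> C (E i),
      is_zero (E d.+2),
      lker (delta 0%N) = 0%VS
    & forall i, (i <= d)%N -> limg (delta i) = lker (delta i.+1)].

Definition canonical_obj (U M : modA) (V : nat -> modA) (n : nat) : modA :=
  match n with
  | 0%N => U
  | 1%N => M
  | i.+2 => V i
  end.

(* 0 -> U -> M -> V 0 -> ... -> V d.-1 -> 0, so that V i is the term V^(i+1)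
   and V d = 0; the last two clauses are the exactness of
   0 -> Hom(W, V 0) -> ... -> Hom(W, V d.-1) -> Hom(W, V d) = 0. *)
Definition canonical_seq (d : nat) (C T : modA -> Prop) (U M : modA)
    (V : nat -> modA)
    (delta : forall i, homA (canonical_obj U M V i)
                            (canonical_obj U M V i.+1)) : Prop :=
  [/\ d_exact d C delta,
      T U,
      forall (W : modA) (g : homA W (V 0%N)), T W ->
        (delta 2 \o g)%VF = 0 -> homA_val g = 0
    & forall (W : modA) (i : nat) (g : homA W (V i.+1)), T W -> (i.+1 < d)%N ->
        (delta i.+3 \o g)%VF = 0 <->
        exists h : homA W (V i), homA_val g = (delta i.+2 \o h)%VF].

Definition torsion_class (d : nat) (C T : modA -> Prop) : Prop :=
  [/\ additive_subcategory T,
      forall X, T X -> C X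
    & forall M, C M -> exists U V delta, @canonical_seq d C T U M V delta].

Definition splitting_torsion_class (d : nat) (C T : modA -> Prop) : Prop :=
  torsion_class d C T /\
  forall M, C M -> exists U V delta,
    @canonical_seq d C T U M V delta /\ @split_mono U M (delta 0%N).

End ModuleCategory.

Section Spine.
Variable T : Type.

Definition proper_incl (U V : T -> Prop) : Prop :=
  (forall x, U x -> V x) /\ ~ (forall x, V x -> U x).

(* x 0 < x 1 < ... < x m in the family L of subclasses of T, ordered by
   inclusion. *)
Definition is_chain (L : (T -> Prop) -> Prop) (m : nat) (x : nat -> T -> Prop) :
    Prop :=
  (forall i, (i <= m)%N -> L (x i)) /\
  (forall i, (i < m)%N -> proper_incl (x i) (x i.+1)).

Definition spine (L : (T -> Prop) -> Prop) (U : T -> Prop) : Prop :=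
  exists m x,
    [/\ is_chain L m x,
        forall m' x', is_chain L m' x' -> (m' <= m)%N
      & exists2 i, (i <= m)%N & x i = U].

End Spine.

(* Main.v *)
From HB Require Import structures.
Require Import Defs.
From mathcomp Require Import all_boot all_order all_algebra all_field.
From mathcomp Require Import boolp.

Set Implicit Arguments.
Unset Strict Implicit.
Unset Printing Implicit Defensive.

Import GRing.Theory.
Local Open Scope ring_scope.

(* Since M has no cycles, the relation "Hom(N_i, N_j) <> 0" on the n indecomposables
   generates a partial order.  For an up-closed set J of indecomposables there
   is no nonzero map from J to its complement, so every module splits as an
   object of add J plus one admitting no map from add J, and add J is a splitting
   torsion class; conversely every splitting torsion class has this form.  Up-sets
   can be grown one element at a time through any given one, so the maximal
   chains have length n, and all splitting classes lie on one.

   Conversely a chain T_0 < ... < T_n acquires a single indecomposable X at each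
   step T < T'.  Let 0 -> U -> X -> V^1 -> ... be canonical for T.  The map
   X -> V^1 factors through the T'-torsion part of V^1, so it is injective or
   factors through an object of T.  In the second case it vanishes, because
   the T-torsion parts of the V^i form a contractible complex, and X = U would
   lie in T.  Hence U = 0 and Hom(T, X) = 0, which makes each T_i
   Hom-orthogonal to the indecomposables outside it. *)

(** * Homomorphisms, isomorphisms and direct sums of modules *)

Section Modules.
Variables (k : fieldType) (A : falgType k).
Local Notation modA := (fdmod A).
Implicit Types (M N X Y Z W : modA) (C T : modA -> Prop).

Lemma actD M (u v : M) a : act (u + v) a = act u a + act v a.
Proof. by have := act_linearl a 1 u v; rewrite !scale1r. Qed.

Lemma act0 M a : act (0 : M) a = 0.
Proof. by apply: (addrI (act (0 : M) a)); rewrite -actD !addr0. Qed.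

Lemma actN M (v : M) a : act (- v) a = - act v a.
Proof. by apply: (addrI (act v a)); rewrite -actD !subrr act0. Qed.

Section HomOf.
Variables (M N : modA) (f : M -> N).
Hypotheses (f_lin : linear f) (f_act : forall v a, f (act v a) = act (f v) a).

Let f_linear : {linear M -> N} := HB.pack f (GRing.isLinear.Build k M N _ f f_lin).

Fact homA_of_act v a : linfun f_linear (act v a) = act (linfun f_linear v) a.
Proof. by rewrite !lfunE. Qed.

Definition homA_of : homA M N := HomA homA_of_act.

Lemma homA_ofE v : homA_of v = f v.
Proof. exact: lfunE. Qed.

End HomOf.

Fact homA0_lin M N : linear (fun _ : M => 0 : N).
Proof. by move=> c u v; rewrite scaler0 addr0. Qed.
Fact homA0_act M N (v : M) (a : A) : 0 = act (0 : N) a.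
Proof. by rewrite act0. Qed.
Definition homA0 M N : homA M N := homA_of (@homA0_lin M N) (@homA0_act M N).

Fact homA_id_lin M : linear (@id M). Proof. by []. Qed.
Definition homA_id M : homA M M := homA_of (@homA_id_lin M) (fun _ _ => erefl).

Section HomOperations.
Variables M N W : modA.

Fact compA_lin (g : homA N W) (f : homA M N) : linear (fun v => g (f v)).
Proof. by move=> c u v; rewrite !linearP. Qed.
Fact compA_act (g : homA N W) (f : homA M N) v a :
  g (f (act v a)) = act (g (f v)) a.
Proof. by rewrite !homA_act. Qed.
Definition compA g f : homA M W := homA_of (compA_lin g f) (compA_act g f).

Fact subA_lin (f g : homA M N) : linear (fun v => f v - g v).
Proof. by move=> c u v; rewrite !linearP /= scalerBr addrACA scalerN. Qed.
Fact subA_act (f g : homA M N) v a :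
  f (act v a) - g (act v a) = act (f v - g v) a.
Proof. by rewrite !homA_act actD actN. Qed.
Definition subA f g : homA M N := homA_of (subA_lin f g) (subA_act f g).

Fact pairA_lin (f : homA M N) (g : homA M W) :
  linear (fun v => (f v, g v) : dsum N W).
Proof. by move=> c u v; rewrite !linearP. Qed.
Fact pairA_act (f : homA M N) (g : homA M W) v a :
  ((f (act v a), g (act v a)) : dsum N W) = act ((f v, g v) : dsum N W) a.
Proof. by rewrite !homA_act. Qed.
Definition pairA f g : homA M (dsum N W) :=
  homA_of (pairA_lin f g) (pairA_act f g).

Fact fstA_lin : linear (fun v : dsum M N => v.1). Proof. by []. Qed.
Definition fstA : homA (dsum M N) M := homA_of fstA_lin (fun _ _ => erefl).

Fact sndA_lin : linear (fun v : dsum M N => v.2). Proof. by []. Qed.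
Definition sndA : homA (dsum M N) N := homA_of sndA_lin (fun _ _ => erefl).

End HomOperations.

Definition inlA M N : homA M (dsum M N) := pairA (homA_id M) (homA0 M N).
Definition inrA M N : homA N (dsum M N) := pairA (homA0 N M) (homA_id N).

Definition dmapA M N X Y (f : homA M X) (g : homA N Y) :
    homA (dsum M N) (dsum X Y) :=
  pairA (compA f (fstA M N)) (compA g (sndA M N)).

Lemma homA0E M N v : homA0 M N v = 0. Proof. exact: homA_ofE. Qed.
Lemma homA_idE M v : homA_id M v = v. Proof. exact: homA_ofE. Qed.
Lemma compAE M N W (g : homA N W) (f : homA M N) v : compA g f v = g (f v).
Proof. exact: homA_ofE. Qed.
Lemma subAE M N (f g : homA M N) v : subA f g v = f v - g v.
Proof. exact: homA_ofE. Qed.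
Lemma pairAE M N W (f : homA M N) (g : homA M W) v : pairA f g v = (f v, g v).
Proof. exact: homA_ofE. Qed.
Lemma fstAE M N v : fstA M N v = v.1. Proof. exact: homA_ofE. Qed.
Lemma sndAE M N v : sndA M N v = v.2. Proof. exact: homA_ofE. Qed.
Lemma inlAE M N v : inlA M N v = (v, 0).
Proof. by rewrite pairAE homA0E homA_idE. Qed.
Lemma inrAE M N v : inrA M N v = (0, v).
Proof. by rewrite pairAE homA0E homA_idE. Qed.
Lemma dmapAE M N X Y (f : homA M X) (g : homA N Y) v :
  dmapA f g v = (f v.1, g v.2).
Proof. by rewrite pairAE !compAE fstAE sndAE. Qed.

Definition homAE :=
  (homA0E, homA_idE, inlAE, inrAE, dmapAE, compAE, subAE, pairAE, fstAE, sndAE).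

Lemma homA_eqP M N (f : 'Hom(M, N)) (g : homA M N) :
  homA_val g = f <-> forall v, g v = f v.
Proof. by split=> [-> // | /lfunP]. Qed.

Lemma comp_eq0P M N W (g : homA N W) (f : homA M N) :
  (g \o f)%VF = 0 <-> forall v, g (f v) = 0.
Proof.
split=> [gf v | gf]; last by apply/lfunP=> v; rewrite comp_lfunE gf zero_lfunE.
by rewrite -comp_lfunE gf zero_lfunE.
Qed.

Lemma comp_eq1P M N (g : homA N M) (f : homA M N) :
  (g \o f)%VF = \1%VF <-> cancel f g.
Proof.
split=> [gf v | gf]; first by rewrite -comp_lfunE gf id_lfunE.
by apply/lfunP=> v; rewrite comp_lfunE gf id_lfunE.
Qed.

Lemma is_isoP M N (f : homA M N) :
  is_iso f <-> exists g : homA N M, cancel f g /\ cancel g f.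
Proof.
by split=> -[g [fg gf]]; exists g; split; apply/comp_eq1P.
Qed.

Lemma is_zeroP M : is_zero M <-> forall v : M, v = 0.
Proof.
rewrite /is_zero; split=> [/eqP|M0].
  by rewrite dimv_eq0 => /eqP M0 v; apply/eqP; rewrite -memv0 -M0 memvf.
by apply/eqP; rewrite dimv_eq0 -subv0; apply/subvP=> v _; rewrite (M0 v) mem0v.
Qed.

Lemma isomorphicP M N :
  isomorphic M N <->
  exists (f : homA M N) (g : homA N M), cancel f g /\ cancel g f.
Proof.
by split=> [[f /is_isoP[g]]|[f [g fg]]]; exists f; [|apply/is_isoP]; exists g.
Qed.

Lemma isomorphic_sym M N : isomorphic M N -> isomorphic N M.
Proof. by move=> /isomorphicP[f [g [fg gf]]]; apply/isomorphicP; exists g, f. Qed.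

Lemma isomorphic_trans N M X : isomorphic M N -> isomorphic N X -> isomorphic M X.
Proof.
move=> /isomorphicP[f [f' [fK f'K]]] /isomorphicP[g [g' [gK g'K]]].
apply/isomorphicP; exists (compA g f), (compA f' g').
by split=> v; rewrite !homAE ?gK ?f'K ?fK ?g'K.
Qed.

Lemma isomorphic_bij M N (f : homA M N) :
  (forall v, f v = 0 -> v = 0) -> (forall w, exists v, f v = w) ->
  isomorphic M N.
Proof.
move=> f_inj f_surj.
have f0 : lker f == 0%VS.
  rewrite -subv0; apply/subvP=> v; rewrite memv_ker memv0 => /eqP fv.
  by rewrite (f_inj v).
have fV w : f ((f^-1)%VF w) = w.
  by have [v <-] := f_surj w; rewrite lker0_lfunK.
have fV_act w a : (f^-1)%VF (act w a) = act ((f^-1)%VF w) a.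
  by have [v <-] := f_surj w; rewrite -homA_act !lker0_lfunK.
apply/isomorphicP; exists f, (HomA fV_act).
by split=> v /=; [rewrite lker0_lfunK | rewrite fV].
Qed.

Lemma dim_isomorphic M N : isomorphic M N -> \dim {: M} = \dim {: N}.
Proof.
move=> /isomorphicP[f [g [fK gK]]].
have f0 : lker f == 0%VS by apply/lker0P; apply: can_inj fK.
rewrite -(limg_dim_eq (f := f) (U := fullv)); last first.
  by rewrite (eqP f0) capv0.
congr (\dim _); apply/vspaceP=> v; rewrite memvf.
by rewrite -(gK v) memv_img ?memvf.
Qed.

Lemma dim_dsum M N : \dim {: dsum M N} = (\dim {: M} + \dim {: N})%N.
Proof. by rewrite !dimvf. Qed.

(** Induction on dimension: a nonzero decomposable module is isomorphic to a sum of two nonzero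
    modules, both of smaller dimension. This packages the existence of decompositions into
    indecomposables. *)
Lemma modA_ind (P : modA -> Prop) :
  (forall X Y, isomorphic X Y -> P Y -> P X) ->
  (forall X, is_zero X -> P X) ->
  (forall X Y, P X -> P Y -> P (dsum X Y)) ->
  (forall X, indecomposable X -> P X) ->
  forall M, P M.
Proof.
move=> P_iso P0 P_sum P_indec M.
have [n] := ubnP (\dim {: M}); elim: n M => // n IHn M; rewrite ltnS => dM.
have [/P0//|M0] := EM (is_zero M).
have [/P_indec//|Mdec] := EM (indecomposable M).
have [X [Y [MXY X0 Y0]]] :
    exists X Y, [/\ isomorphic M (dsum X Y), ~ is_zero X & ~ is_zero Y].
  apply: contrapT => noXY; apply: Mdec; split=> // X Y MXY.
  apply: contrapT => XY0; apply: noXY; exists X, Y.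
  by split=> // ?; apply: XY0; [left | right].
have := dim_isomorphic MXY; rewrite dim_dsum => dXY.
have X_gt0 : (0 < \dim {: X})%N by rewrite lt0n; apply/eqP.
have Y_gt0 : (0 < \dim {: Y})%N by rewrite lt0n; apply/eqP.
apply: P_iso MXY _; apply: P_sum; apply: IHn; apply: leq_trans dM; rewrite dXY.
  by rewrite -addn1 leq_add2l.
by rewrite -add1n leq_add2r.
Qed.

Definition zeroA : modA.
Proof.
by refine (@FDMod k A 'rV[k]_0 (fun _ _ => 0) _ _ _ _) => *;
  rewrite ?[LHS]thinmx0 ?[RHS]thinmx0 // => c u v;
  rewrite [LHS]thinmx0 [RHS]thinmx0.
Defined.

Lemma zeroA_eq0 (v : zeroA) : v = 0.
Proof. exact: thinmx0. Qed.

Lemma zeroA_zero : is_zero zeroA.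
Proof. exact/is_zeroP/zeroA_eq0. Qed.

Lemma additive_iso C X Y :
  additive_subcategory C -> isomorphic X Y -> C X -> C Y.
Proof. by case=> iso _ _ _; apply: iso. Qed.

(* The torsion submodule of Y, characterized by its universal property. *)
Definition radical T Y U (b : homA U Y) : Prop :=
  [/\ T U, forall u, b u = 0 -> u = 0
    & forall W (g : homA W Y), T W -> exists a : homA W U, forall w, b (a w) = g w].

(** * Torsion radicals and canonical sequences *)

Section Torsion.
Variables (d : nat) (C T : modA -> Prop).
Hypotheses (d_gt0 : (0 < d)%N) (T_tors : torsion_class d C T).

Section CanonicalSeq.
Variables (U X : modA) (V : nat -> modA).
Variable delta : forall i, homA (canonical_obj U X V i) (canonical_obj U X V i.+1).
Hypothesis canon : canonical_seq d C T delta.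

Lemma canonical_inj u : delta 0 u = 0 -> u = 0.
Proof.
move=> du; have [[_ _ ker0 _] _ _ _] := canon.
by apply/eqP; rewrite -memv0 -ker0 memv_ker du.
Qed.

Lemma canonical_comp0 i x : (i <= d)%N -> delta i.+1 (delta i x) = 0.
Proof.
move=> lid; have [[_ _ _ exact] _ _ _] := canon.
by apply/eqP; rewrite -memv_ker -(exact i lid) memv_img ?memvf.
Qed.

Lemma canonical_exact i x :
  (i <= d)%N -> delta i.+1 x = 0 -> exists y, delta i y = x.
Proof.
move=> lid dx; have [[_ _ _ exact] _ _ _] := canon.
have : x \in lker (delta i.+1) by rewrite memv_ker dx.
by rewrite -(exact i lid) => /memv_imgP[y _ ->]; exists y.
Qed.

Lemma canonical_V i : (i <= d)%N -> C (V i).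
Proof.
have [[CE zE _ _] _ _ _] := canon; have [Tadd TC _] := T_tors.
rewrite leq_eqVlt => /predU1P[->|lid]; last exact: (CE i.+2).
by apply: TC; case: Tadd => _ T0 _ _; apply: T0.
Qed.

Lemma canonical_Vd i (x : V i) : i = d -> x = 0.
Proof.
move=> i_d; rewrite i_d in x *; have [[_ /is_zeroP zE _ _] _ _ _] := canon.
exact: zE.
Qed.

Lemma canonical_hom_inj W (g : homA W (V 0)) :
  T W -> (forall w, delta 2 (g w) = 0) -> forall w, g w = 0.
Proof.
have [_ _ inj _] := canon; move=> TW dg w.
by rewrite (inj W g TW) ?zero_lfunE //; apply/(@comp_eq0P _ _ _ (delta 2) g).
Qed.

Lemma canonical_hom_exact W i (g : homA W (V i.+1)) :
  T W -> (i.+1 < d)%N -> (forall w, delta i.+3 (g w) = 0) ->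
  exists h : homA W (V i), forall w, delta i.+2 (h w) = g w.
Proof.
have [_ _ _ exact] := canon; move=> TW lid dg.
have /(exact _ _ _ TW lid)[h gh] : (delta i.+3 \o g)%VF = 0.
  exact/(@comp_eq0P _ _ _ (delta i.+3) g).
by exists h => w; rewrite gh comp_lfunE.
Qed.

(** For [W] in [T], the composite of [g : W -> X] with [delta 1] is killed by [delta 2], hence zero
    by injectivity of Hom at [V 0]. So [g] lands in the image of [delta 0], where [delta 0] can be
    inverted. *)
Lemma canonical_radical : radical T (delta 0).
Proof.
have [_ TU _ _] := canon; split=> // [u|W g TW]; first exact: canonical_inj.
have gK w : exists u, delta 0 u = g w.
  apply: canonical_exact => //.
  have := @canonical_hom_inj W (compA (delta 1) g) TW _ w.
  by rewrite homAE; apply=> v; rewrite homAE canonical_comp0.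
have d0 : lker (delta 0) == 0%VS by have [[_ _ -> _] _ _ _] := canon.
have h_act v a : ((delta 0)^-1 \o g)%VF (act v a) = act (((delta 0)^-1 \o g)%VF v) a.
  have [u uv] := gK v; rewrite !comp_lfunE homA_act -uv -homA_act.
  by rewrite !lker0_lfunK.
exists (HomA h_act) => w /=.
by have [u uw] := gK w; rewrite comp_lfunE -uw lker0_lfunK.
Qed.

End CanonicalSeq.

Lemma radical_exists Y : C Y -> exists U (b : homA U Y), radical T b.
Proof.
have [_ _ canonM] := T_tors => /canonM[U [V [delta canon]]].
by exists U, (delta 0); apply: (canonical_radical canon).
Qed.

Section CanonicalSeq.
Variables (U X : modA) (V : nat -> modA).
Variable delta : forall i, homA (canonical_obj U X V i) (canonical_obj U X V i.+1).
Hypothesis canon : canonical_seq d C T delta.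

(* The radicals of the V i form a complex on which Hom(W, -) is exact for W in T,
   that is a contractible one; s is one component of the contraction. *)
Lemma radical_contraction i W (b : homA W (V i)) :
  (i < d)%N -> radical T b ->
  exists W' (b' : homA W' (V i.+1)) (u : homA W W') (s : homA W' W),
  [/\ radical T b', forall w, b' (u w) = delta i.+2 (b w)
    & forall w, delta i.+2 (b (s (u w))) = delta i.+2 (b w)].
Proof.
(* The universal property of the radical turns the differential into a map between the radicals of
   consecutive terms. *)
have restrict j (Z : modA) (b' : homA Z (V j)) : (j < d)%N -> radical T b' ->
  exists W' (b'' : homA W' (V j.+1)) (u : homA Z W'),
    radical T b'' /\ forall z, b'' (u z) = delta j.+2 (b' z).
  move=> ljd [TZ _ _].
  have [W' [b'' b''rad]] := radical_exists (canonical_V canon ljd).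
  have [_ _ lift] := b''rad.
  have [u uE] := lift Z (compA (delta j.+2) b') TZ.
  by exists W', b'', u; split=> // z; rewrite uE homAE.
(* Descending induction on [i], with [r = d - i.+1]. At [r = 0] the next term [V d] is zero, so
   [s = 0] works. *)
move=> lid; have := subnK lid; move: (d - i.+1)%N => r.
elim: r => [|r IHr] in i W b lid * => def_d brad;
    have [W' [b' [u [b'rad b'u]]]] := restrict i W b lid brad.
  exists W', b', u, (homA0 _ _); split=> // w.
  have V0 (x : V i.+1) : x = 0 by apply: (canonical_Vd canon x).
  by rewrite [LHS]V0 [RHS]V0.
have lSid : (i.+1 < d)%N by rewrite -def_d addSnnS leq_addl.
have [] := IHr i.+1 W' b' lSid _ b'rad; first by rewrite addnS -addSn.
move=> W'' [b'' [u' [s' [[_ b''inj _] b''u' s'u']]]].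
have [TW' _ _] := b'rad; have [_ _ lift] := brad.
(* By induction [b' - b' s' u'] is killed by [delta i.+3], so it lifts along [delta i.+2] to [V i],
   and then to the radical [W]. Composing with [u] removes the correction term, because
   [u' u = 0]. *)
have [|h dh] := canonical_hom_exact canon
    (g := subA b' (compA b' (compA s' u'))) TW' lSid.
  by move=> w; rewrite !homAE linearB [X in _ - X]s'u' subrr.
have [s bs] := lift W' h TW'.
have u'u w : u' (u w) = 0.
  apply: b''inj; rewrite b''u' b'u.
  exact: (canonical_comp0 canon).
exists W', b', u, s; split=> // w.
by rewrite bs dh !homAE u'u !linear0 addr0 b'u.
Qed.

(* Hence the map from the radical of V 0 to that of V 1 is a split
   monomorphism, while its composite with X -> V 0 vanishes. *)
Lemma canonical_factor0 W (a : homA X W) (b : homA W (V 0)) :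
  T W -> (forall x, b (a x) = delta 1 x) -> forall x, delta 1 x = 0.
Proof.
move=> TW ba x.
have [U0 [b0 b0rad]] := radical_exists (canonical_V canon (leq0n d)).
have [TU0 b0_inj b0_lift] := b0rad.
have [c bc] := b0_lift W b TW.
have [U1 [b1 [u [s [[_ b1_inj _] b1u su]]]]] := radical_contraction d_gt0 b0rad.
have uca : u (c (a x)) = 0.
  by apply: b1_inj; rewrite b1u bc ba (canonical_comp0 canon).
(* The contraction gives this equation only after applying [delta 2], which is injective on maps
   from objects of [T] to [V 0]. *)
suff su_id : b0 (s (u (c (a x)))) = b0 (c (a x)).
  by rewrite -ba -bc -su_id uca !linear0.
have := canonical_hom_inj canon (g := subA (compA b0 (compA s u)) b0) TU0.
move=> H; apply/eqP; rewrite -subr_eq0.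
have := H _ (c (a x)); rewrite !homAE => -> // w.
by rewrite !homAE linearB [X in X - _]su subrr.
Qed.

End CanonicalSeq.

End Torsion.

(** * Consequences of the absence of cycles *)

(** Otherwise [f] alone is a cycle with [t = 1]. *)
Lemma indecomposable_endo C X (f : homA X X) :
  ~ has_cycle C -> C X -> indecomposable X -> is_iso f \/ forall x, f x = 0.
Proof.
move=> acyclic CX Xind; apply: contrapT => /not_orP[f_niso f_n0].
apply: acyclic; exists 1%N, (fun _ => X), (fun _ => f); split=> // _; split=> //.
by move=> f0; apply: f_n0 => x; rewrite f0 zero_lfunE.
Qed.

(** Decompose [Y] into indecomposables. A summand outside [T] is a copy of [X], so the component of
    [f] there is an isomorphism, making [f] injective, or zero. If no component is injective, [f]
    factors through the sum of the objects of [T] met along the way. *)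
Lemma injective_or_factor C T T' X :
    ~ has_cycle C -> C X -> indecomposable X ->
    additive_subcategory T -> additive_subcategory T' ->
    (forall Y, T' Y -> indecomposable Y -> ~ T Y -> isomorphic Y X) ->
  forall Y (f : homA X Y), T' Y ->
  (forall x, f x = 0 -> x = 0) \/
  exists W (a : homA X W) (b : homA W Y), T W /\ forall x, b (a x) = f x.
Proof.
move=> acyclic CX Xind [_ T0 Tsum _] [T'iso T'0 T'sum T'summand] T'X.
elim/modA_ind => [Y Z YZ IH | Y Y0 | Y Z IHY IHZ | Y Yind] f T'Y.
- have [g [g' [gK g'K]]] := (isomorphicP _ _).1 YZ.
  have [|gf_inj|[W [a [b [TW ba]]]]] := IH (compA g f); first exact: T'iso YZ T'Y.
    by left=> x fx; apply: gf_inj; rewrite homAE fx linear0.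
  by right; exists W, a, (compA g' b); split=> // x; rewrite homAE ba homAE gK.
- right; exists Y, f, (homA_id Y); split=> [|x]; [exact: T0 | by rewrite homAE].
- have [T'Y1 T'Z] := T'summand _ _ T'Y.
  have [f_inj|[W [a [b [TW ba]]]]] := IHY (compA (fstA Y Z) f) T'Y1.
    by left=> x fx; apply: f_inj; rewrite homAE fx linear0.
  have [f_inj|[W' [a' [b' [TW' ba']]]]] := IHZ (compA (sndA Y Z) f) T'Z.
    by left=> x fx; apply: f_inj; rewrite homAE fx linear0.
  right; exists (dsum W W'), (pairA a a'), (dmapA b b').
  split=> [|x]; first exact: Tsum.
  by rewrite !homAE ba ba' !homAE; case: (f x).
- have [TY|nTY] := EM (T Y).
    by right; exists Y, f, (homA_id Y); split=> // x; rewrite homAE.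
  have [g [g' [gK g'K]]] := (isomorphicP _ _).1 (T'X Y T'Y Yind nTY).
  have [/is_isoP[h [gfK _]]|gf0] :=
      indecomposable_endo (compA g f) acyclic CX Xind.
    by left=> x fx; rewrite -(gfK x) homAE fx !linear0.
  right; exists zeroA, (homA0 _ _), (homA0 _ _); split=> [|x].
    exact/T0/zeroA_zero.
  by rewrite homAE -(gK (f x)); have := gf0 x; rewrite homAE => ->; rewrite linear0.
Qed.

(* As X lies in T', so does the image of X -> V 0, hence this map factors through
   the T'-radical of V 0; if it is not injective then by absence of cycles it
   even factors through an object of T. *)
Lemma torsion_cover_orthogonal d C T T' X :
    (0 < d)%N -> ~ has_cycle C ->
    torsion_class d C T -> torsion_class d C T' ->
    T' X -> indecomposable X -> ~ T X ->
    (forall Y, T' Y -> indecomposable Y -> ~ T Y -> isomorphic Y X) ->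
  forall W (g : homA W X), T W -> forall w, g w = 0.
Proof.
move=> d_gt0 acyclic Ttors T'tors T'X Xind nTX T'uniq W g TW w.
have [Tadd TC canonT] := Ttors; have [T'add T'C _] := T'tors.
have [U [V [delta canon]]] := canonT X (T'C X T'X).
have [U' [b [T'U' b_inj b_lift]]] :=
  radical_exists d_gt0 T'tors (canonical_V Ttors canon (leq0n d)).
have [a ba] := b_lift X (delta 1) T'X.
have d10 u : delta 1 (delta 0 u) = 0 by apply: (canonical_comp0 canon).
have [a_inj|[W' [c [e [TW' ec]]]]] :=
    injective_or_factor acyclic (T'C X T'X) Xind Tadd T'add T'uniq a T'U'.
  (* If [a] is injective, so is [delta 1 = b a]; then [delta 0] vanishes, and with it [g], which
     factors through [delta 0]. *)
  have [_ _ /(_ W g TW)[h hg]] := canonical_radical d_gt0 canon.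
  by rewrite -hg; apply/a_inj/b_inj; rewrite ba d10.
(* Otherwise [delta 1 = 0], so [delta 0] is an isomorphism from [U] onto [X], which puts [X] in
   [T]. *)
case: nTX; have [_ TU _ _] := canon.
have d1 : forall x, delta 1 x = 0.
  apply: (canonical_factor0 d_gt0 Ttors canon (a := c) (b := compA b e)) => // x.
  by rewrite homAE ec ba.
apply: (additive_iso Tadd _ TU); apply: (isomorphic_bij (f := delta 0)).
  exact: (canonical_inj canon).
by move=> x; apply: (canonical_exact canon).
Qed.

(** With [r] a retraction of [delta 0], the idempotent [delta 0 \o r] of [N] is an isomorphism or
    zero. The first would put [N] in [T]; the second kills [delta 0], through which [g] factors. *)
Lemma splitting_orthogonal d C T W N (g : homA W N) :
  (0 < d)%N -> ~ has_cycle C -> splitting_torsion_class d C T ->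
  T W -> C N -> indecomposable N -> ~ T N -> forall w, g w = 0.
Proof.
move=> d_gt0 acyclic [Ttors split] TW CN Nind nTN w.
have [Tadd _ _] := Ttors.
have [U [V [delta [canon [r /comp_eq1P rK]]]]] := split N CN.
have [_ TU _ _] := canon.
have [_ _ /(_ W g TW)[h <-]] := canonical_radical d_gt0 canon.
have [/is_isoP[e [_ eK]]|dr0] :=
    indecomposable_endo (compA (delta 0) r) acyclic CN Nind.
  case: nTN; apply: (additive_iso Tadd _ TU).
  apply: (isomorphic_bij (f := delta 0)); first exact: (canonical_inj canon).
  by move=> x; exists (r (e x)); rewrite -[RHS]eK homAE.
by have := dr0 (delta 0 (h w)); rewrite homAE rK.
Qed.

(** * Splitting torsion classes from Hom-orthogonality *)

Lemma exactP M N X (f : homA M N) (g : homA N X) :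
  (forall v, g (f v) = 0) -> (forall w, g w = 0 -> exists v, f v = w) ->
  limg f = lker g.
Proof.
move=> gf0 gf_exact; apply/vspaceP=> w; apply/memv_imgP/idP=> [[v _ ->]|].
  by rewrite memv_ker gf0.
by rewrite memv_ker => /eqP/gf_exact[v <-]; exists v; rewrite ?memvf.
Qed.

(** Collects the indecomposable summands of [M] lying in [T] into [U] and the others into [N]. *)
Lemma orthogonal_decomposition C T :
    additive_subcategory C -> additive_subcategory T ->
    (forall W N (g : homA W N), T W -> C N -> indecomposable N -> ~ T N ->
       forall w, g w = 0) ->
  forall M, C M -> exists U N,
    [/\ isomorphic M (dsum U N), T U, C N
      & forall W (g : homA W N), T W -> forall w, g w = 0].
Proof.
move=> [Ciso C0 Csum Csummand] [_ T0 Tsum _] orth.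
have T_zero : T zeroA by apply/T0/zeroA_zero.
have C_zero : C zeroA by apply/C0/zeroA_zero.
have dsum0 M : isomorphic M (dsum M zeroA).
  apply/isomorphicP; exists (inlA M zeroA), (fstA M zeroA).
  split=> v; rewrite !homAE //; case: v => v z /=; congr pair.
  by apply/esym/zeroA_eq0.
have dsum0l M : isomorphic M (dsum zeroA M).
  apply/isomorphicP; exists (inrA zeroA M), (sndA zeroA M).
  split=> v; rewrite !homAE //; case: v => z v /=; congr pair.
  by apply/esym/zeroA_eq0.
elim/modA_ind => [M M' MM' IH | M M0 | M M' IHM IHM' | M Mind] CM.
- have [|U [N [M'UN TU CN orthN]]] := IH; first exact: Ciso MM' CM.
  by exists U, N; split=> //; apply: isomorphic_trans MM' M'UN.
- by exists M, zeroA; split=> //; [exact: T0 | move=> W g _ w; exact: zeroA_eq0].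
- have [CM1 CM'] := Csummand _ _ CM.
  have [U [N [MUN TU CN oN]]] := IHM CM1.
  have [U' [N' [MUN' TU' CN' oN']]] := IHM' CM'.
  have [f [f' [fK f'K]]] := (isomorphicP _ _).1 MUN.
  have [g [g' [gK g'K]]] := (isomorphicP _ _).1 MUN'.
  exists (dsum U U'), (dsum N N'); split; [|exact: Tsum|exact: Csum|].
    apply/isomorphicP.
    exists (pairA (dmapA (compA (fstA U N) f) (compA (fstA U' N') g))
                  (dmapA (compA (sndA U N) f) (compA (sndA U' N') g))).
    exists (pairA (compA f' (dmapA (fstA U U') (fstA N N')))
                  (compA g' (dmapA (sndA U U') (sndA N N')))).
    split=> [[x y]|[[u u'] [n n']]]; rewrite !homAE /=.
      by rewrite -!surjective_pairing fK gK.
    by rewrite f'K g'K.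
  move=> W h TW w; rewrite [LHS]surjective_pairing.
  have := oN W (compA (fstA N N') h) TW w; have := oN' W (compA (sndA N N') h) TW w.
  by rewrite !homAE => -> ->.
- have [TM|nTM] := EM (T M).
    by exists M, zeroA; split=> // W g _ w; apply: zeroA_eq0.
  by exists zeroA, M; split=> // W g TW; apply: orth.
Qed.

Lemma orthogonal_splitting d C T :
    (0 < d)%N -> additive_subcategory C -> additive_subcategory T ->
    (forall X, T X -> C X) ->
    (forall W N (g : homA W N), T W -> C N -> indecomposable N -> ~ T N ->
       forall w, g w = 0) ->
  splitting_torsion_class d C T.
Proof.
move=> d_gt0 Cadd Tadd TC orth.
suff split M : C M -> exists U V delta,
    @canonical_seq k A d C T U M V delta /\ @split_mono k A U M (delta 0).
  split=> //; split=> // M /split[U [V [delta [canon _]]]].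
  by exists U, V, delta.
case/(orthogonal_decomposition Cadd Tadd orth) => U [N [MUN TU CN orthN]].
have [f [f' [fK f'K]]] := (isomorphicP _ _).1 MUN.
have C_zero : C zeroA by case: Cadd => _ C0 _ _; apply/C0/zeroA_zero.
(* The canonical sequence is the split sequence [0 -> U -> M -> N -> 0], padded with zeros to the
   length required by [d]. *)
pose V i := if i is 0 then N else zeroA.
pose delta i :=
  match i return homA (canonical_obj U M V i) (canonical_obj U M V i.+1) with
  | 0 => compA f' (inlA U N) | 1 => compA (sndA U N) f | _.+2 => homA0 _ _
  end.
have d0 u : delta 0 u = f' (u, 0) by rewrite !homAE.
have d1 m : delta 1 m = (f m).2 by rewrite !homAE.
have d2 i v : delta i.+2 v = 0 by rewrite homAE.
exists U, V, delta; split; last first.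
  by exists (compA (fstA U N) f); apply/comp_eq1P => u; rewrite d0 !homAE f'K.
split=> // [|W g TW _|W i g TW lid].
- split.
  + move=> [|[|[|i]]] _ //=; first exact: TC.
    case: Cadd => Ciso _ Csum _; apply: Ciso (isomorphic_sym MUN) _.
    by apply: Csum => //; apply: TC.
  + by case: (d) d_gt0 => // d' _; apply: zeroA_zero.
  + apply/eqP; rewrite -subv0; apply/subvP=> u; rewrite memv_ker memv0 => /eqP.
    rewrite d0 => fu; have := f'K (u, 0); rewrite fu linear0.
    by case=> <-.
  + move=> [|[|i]] _; apply: exactP.
    * by move=> u; rewrite d0 d1 f'K.
    * move=> m; rewrite d1 => fm0; exists (f m).1.
      by rewrite d0 -[RHS]fK -fm0 -surjective_pairing.
    * by move=> m; rewrite d2.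
    * by move=> n _; exists (f' (0, n)); rewrite d1 f'K.
    * by move=> v; rewrite d2.
    * by move=> v _; exists 0; rewrite d2; exact: esym (zeroA_eq0 v).
- by apply/lfunP=> w; rewrite zero_lfunE; apply: orthN.
- split=> _; last by apply/comp_eq0P => w; apply: d2.
  by exists (homA0 _ _); apply/homA_eqP => w; rewrite comp_lfunE d2; apply: zeroA_eq0.
Qed.

End Modules.

(** * Chains of up-closed sets in a finite acyclic relation *)

Section FiniteCombinatorics.
Variables (I : finType) (e : rel I).
Implicit Types J K : {set I}.

Definition up_closed J := forall i j, i \in J -> e i j -> j \in J.

(** Take [i] in [J] reaching the fewest elements. If [i] had an arrow to [j] in [J], minimality
    would make [j] reach everything [i] reaches, including [i] itself, closing a cycle. *)
Lemma acyclic_sink J :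
  (forall x p, ~ cycle e (x :: p)) -> J != set0 ->
  exists2 i, i \in J & forall j, j \in J -> ~~ e i j.
Proof.
move=> acyclic /set0Pn[i0 Ji0].
pose i := [arg min_(i < i0 in J) #|connect e i|].
have [Ji i_min] : i \in J /\ forall j, j \in J -> (#|connect e i| <= #|connect e j|)%N.
  by rewrite /i; case: arg_minnP.
exists i => // j Jj; apply/negP=> eij.
have sub_ji : connect e j \subset connect e i.
  by apply/subsetP=> x; apply: connect_trans; apply: connect1.
have : connect e j i.
  have /subset_cardP/(_ sub_ji)/(_ i) : #|connect e j| = #|connect e i|.
    by apply/eqP; rewrite eqn_leq subset_leq_card ?i_min.
  by rewrite -!topredE /= connect0.
case/connectP=> p ejp i_last; apply: (acyclic j p).
by rewrite /= rcons_path ejp -i_last.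
Qed.

Hypothesis acyclic : forall x p, ~ cycle e (x :: p).

(** Add to [J] a sink [i] of [K :\: J]: the successors of [i] lie in [K] but not in [K :\: J], hence
    in [J], so the enlarged set is again up-closed. *)
Lemma up_closed_chain J K : up_closed J -> up_closed K -> J \subset K ->
  exists x : nat -> {set I},
  [/\ x 0%N = J, x (#|K| - #|J|)%N = K, forall i, up_closed (x i)
    & forall i, (i < #|K| - #|J|)%N -> x i \proper x i.+1].
Proof.
have [n] := ubnP (#|K| - #|J|); elim: n J => // n IHn J.
rewrite ltnS => leKJn Jup Kup JK.
have [KJ0|] := eqVneq (K :\: J) set0.
  have KJ : K = J by apply/eqP; rewrite eqEsubset JK andbT -setD_eq0 KJ0.
  by exists (fun=> J); rewrite KJ subnn.
case/(acyclic_sink acyclic) => i; rewrite inE => /andP[nJi Ki] sink.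
pose J' := i |: J.
have J'up : up_closed J'.
  move=> j l; rewrite !inE => /predU1P[->|Jj] ejl; last by rewrite (Jup j l) ?orbT.
  have := sink l; rewrite inE (Kup i l) // andbT ejl.
  by case: (l \in J) => [|/(_ isT)]; rewrite ?orbT.
have J'K : J' \subset K by rewrite subUset sub1set Ki.
have cardJ' : #|J'| = #|J|.+1 by rewrite cardsU1 nJi.
have ltJK : (#|J| < #|K|)%N by rewrite -cardJ' subset_leq_card.
have KJ : (#|K| - #|J|)%N = (#|K| - #|J'|).+1 by rewrite cardJ' subnSK.
have [|x [x0 xK xup xlt]] := IHn J' _ J'up Kup J'K; first by rewrite -KJ.
exists (fun n => if n is n'.+1 then x n' else J); rewrite KJ.
split=> // [[|m]|[_|m]] //; last by rewrite ltnS; apply: xlt.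
by rewrite x0 properE subsetUr; apply/subsetPn; exists i; rewrite // setU11.
Qed.

(** Glues a chain from [set0] to [J] and one from [J] to [setT]; they meet at index [#|J|]. *)
Lemma up_closed_maximal_chain J : up_closed J ->
  exists x : nat -> {set I},
  [/\ x #|J| = J, forall i, up_closed (x i)
    & forall i, (i < #|I|)%N -> x i \proper x i.+1].
Proof.
move=> Jup.
have [|x [x0 xJ xup xlt]] := up_closed_chain (J := set0) _ Jup (sub0set J).
  by move=> i j; rewrite inE.
have [|y [y0 _ yup ylt]] := up_closed_chain Jup (K := setT) _ (subsetT J).
  by move=> i j; rewrite !inE.
rewrite cards0 subn0 in xJ xlt; rewrite cardsT in ylt.
exists (fun i => if (i <= #|J|)%N then x i else y (i - #|J|)%N).
split=> [|i|i ltiI]; rewrite ?leqnn //; first by case: ifP.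
case: (ltngtP i #|J|) => [ltiJ|ltJi|iJ].
- exact: xlt.
- by rewrite subSn 1?ltnW //; apply: ylt; rewrite ltn_sub2r // (ltn_trans ltJi).
- by rewrite iJ xJ -y0 subSnn; apply: ylt; rewrite subn_gt0 -iJ.
Qed.

End FiniteCombinatorics.

(** * Torsion classes and up-closed sets of indecomposables *)

Section Classification.
Variables (k : fieldType) (A : falgType k).
Local Notation modA := (fdmod A).
Implicit Types (M X Y Z W : modA) (T : modA -> Prop).

Lemma indecomposable_iso X Y : isomorphic X Y -> indecomposable X -> indecomposable Y.
Proof.
move=> XY [X0 Xind]; split=> [Y0|Z W YZW].
  by apply: X0; rewrite /is_zero (dim_isomorphic XY).
exact: Xind (isomorphic_trans XY YZW).
Qed.

Lemma indecomposable_representatives (C : modA -> Prop) :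
  additive_subcategory C -> finitely_many_indecomposables C ->
  exists (I : finType) (N : I -> modA),
  [/\ forall i, C (N i) /\ indecomposable (N i),
      forall i j, isomorphic (N i) (N j) -> i = j
    & forall X, C X -> indecomposable X -> exists i, isomorphic X (N i)].
Proof.
move=> Cadd [n [N Nall]].
(* The given list may contain repetitions, decomposables and modules outside [C]; [P] keeps the
   least index of each relevant isomorphism class. *)
pose P (i : 'I_n) := `[< (C (N i) /\ indecomposable (N i)) /\
                         forall j, isomorphic (N j) (N i) -> (i <= j)%N >].
exists {i : 'I_n | P i}, (fun i => N (val i)); split=> [i|i j ij|X CX Xind].
- by have /asboolP[] := valP i.
- have /asboolP[_ /(_ _ (isomorphic_sym ij)) le_ij] := valP i.
  have /asboolP[_ /(_ _ ij) le_ji] := valP j.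
  by apply/val_inj/val_inj/eqP; rewrite eqn_leq le_ij.
have [i0 Xi0] := Nall X CX Xind.
pose i := [arg min_(i < i0 | `[< isomorphic X (N i) >]) i].
have [Xi i_min] : isomorphic X (N i) /\ forall j, isomorphic X (N j) -> (i <= j)%N.
  rewrite /i; case: arg_minnP => [|j /asboolP Xj j_min]; first exact/asboolP.
  by split=> // l /asboolP/j_min.
have Pi : P i.
  apply/asboolP; split.
    by split; [exact: additive_iso Xi CX | exact: indecomposable_iso Xi Xind].
  by move=> j ji; apply/i_min/(isomorphic_trans Xi)/isomorphic_sym.
by exists (exist _ i Pi).
Qed.

Variables (d : nat) (C : modA -> Prop) (I : finType) (N : I -> modA).
Hypotheses (d_gt0 : (0 < d)%N) (Cadd : additive_subcategory C).
Hypothesis C_acyclic : ~ has_cycle C.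
Hypothesis N_ind : forall i, C (N i) /\ indecomposable (N i).
Hypothesis N_inj : forall i j, isomorphic (N i) (N j) -> i = j.
Hypothesis N_all : forall X, C X -> indecomposable X -> exists i, isomorphic X (N i).
Implicit Types J : {set I}.

(** Only non-isomorphisms count, so that a closed path of arrows is a cycle in [C]. *)
Definition arrow : rel I := fun i j =>
  `[< exists f : homA (N i) (N j), ~ is_iso f /\ exists x, f x <> 0 >].

Lemma arrow_acyclic i p : ~ cycle arrow (i :: p).
Proof.
move=> /= /(pathP i) ip.
pose c := nth i (i :: p).
(* The last arrow, at [j = size p], returns to the start [i], matching the wrap-around of [ordS]. *)
have arr (j : 'I_(size p).+1) : arrow (c j) (c (ordS j)).
  have := ip j; rewrite size_rcons => /(_ (ltn_ord j)).
  rewrite -rcons_cons nth_rcons /= ltn_ord nth_rcons.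
  have := ltn_ord j; rewrite ltnS leq_eqVlt => /predU1P[jp|ltjp].
    by rewrite jp ltnn eqxx modnn.
  by rewrite ltjp modn_small.
pose mu j := cid (asboolP _ (arr j)).
apply: C_acyclic; exists (size p).+1, (fun j => N (c j)), (fun j => sval (mu j)).
split=> // j; have [f_niso [x f_n0]] := svalP (mu j); have [CN Nind] := N_ind (c j).
by split=> // f0; apply: f_n0; rewrite f0 zero_lfunE.
Qed.

Lemma arrow_closed_hom0 J i j (f : homA (N i) (N j)) :
  up_closed arrow J -> i \in J -> j \notin J -> forall x, f x = 0.
Proof.
move=> Jup Ji nJj x; apply: contrapT => fx0; move/negP: nJj; apply.
have [<- //|nij] := eqVneq i j.
apply: (Jup i j Ji); apply/asboolP; exists f; split; last by exists x.
by move=> f_iso; case/eqP: nij; apply: N_inj; exists f.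
Qed.

Definition index_set T : {set I} := [set i | `[< T (N i) >]].

Lemma in_index_set T i : (i \in index_set T) <-> T (N i).
Proof. by rewrite inE; split=> /asboolP. Qed.

(** By decomposition into indecomposables, additive subcategories of [C] are compared through their
    index sets. *)
Lemma additive_sub_index T T' :
  additive_subcategory T -> additive_subcategory T' -> (forall X, T' X -> C X) ->
  (forall i, T' (N i) -> T (N i)) -> forall X, T' X -> T X.
Proof.
move=> Tadd T'add T'C sub.
have [Tiso T0 Tsum _] := Tadd; have [T'iso _ _ T'summand] := T'add.
elim/modA_ind => [X Y XY IH|X X0|X Y IHX IHY|X Xind] T'X.
- exact: Tiso (isomorphic_sym XY) (IH (T'iso _ _ XY T'X)).
- exact: T0.
- by have [/IHX TX /IHY TY] := T'summand _ _ T'X; apply: Tsum.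
- have [i Xi] := N_all (T'C _ T'X) Xind.
  exact: Tiso (isomorphic_sym Xi) (sub _ (T'iso _ _ Xi T'X)).
Qed.

Lemma index_set_proper T T' :
  additive_subcategory T -> additive_subcategory T' -> (forall X, T' X -> C X) ->
  proper_incl T T' -> index_set T \proper index_set T'.
Proof.
move=> Tadd T'add T'C [TT' nT'T]; apply/properP; split.
  by apply/subsetP=> i /in_index_set/TT' T'i; apply/in_index_set.
apply: contrapT => noi; apply/nT'T/(additive_sub_index Tadd T'add T'C) => i T'i.
apply: contrapT => nTi; apply: noi; exists i; first exact/in_index_set.
by apply/negP=> /in_index_set.
Qed.

(** For up-closed [J] this is the additive closure of the [N i] with [i \in J]. Written as a left
    Hom-orthogonal, its closure under sums and summands is immediate. *)
Definition hom_orthogonal J (M : modA) : Prop :=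
  C M /\ forall i (f : homA M (N i)), i \notin J -> forall x, f x = 0.

Lemma hom_orthogonal_additive J : additive_subcategory (hom_orthogonal J).
Proof.
have [Ciso C0 Csum Csummand] := Cadd; split.
- move=> X Y XY [CX X0]; split=> [|i f nJi y]; first exact: Ciso XY CX.
  have [g [g' [_ g'K]]] := (isomorphicP _ _).1 XY.
  by rewrite -(g'K y) -compAE X0.
- move=> X X0; split=> [|i f _ x]; first exact: C0.
  by rewrite ((is_zeroP _).1 X0 x) linear0.
- move=> X Y [CX X0] [CY Y0]; split=> [|i f nJi [x y]]; first exact: Csum.
  have xy : (x, y) = inlA X Y x + inrA X Y y :> dsum X Y.
    by rewrite !homAE; congr pair; rewrite ?addr0 ?add0r.
  have -> : f (x, y) = compA f (inlA X Y) x + compA f (inrA X Y) y.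
    by rewrite !compAE xy; apply: linearD.
  by rewrite X0 // Y0 // addr0.
- move=> X Y [/Csummand[CX CY] XY0]; split; split=> // i f nJi x.
    by have := XY0 i (compA f (fstA X Y)) nJi (x, 0); rewrite !homAE.
  by have := XY0 i (compA f (sndA X Y)) nJi (0, x); rewrite !homAE.
Qed.

(** For [i] outside [J] the identity of [N i] would have to vanish; for [i] in [J], no nonzero map
    leaves the up-closed set. *)
Lemma hom_orthogonal_index J i :
  up_closed arrow J -> hom_orthogonal J (N i) <-> i \in J.
Proof.
move=> Jup; split=> [[_ Ni0]|Ji]; last first.
  split=> [|j f nJj]; first by case: (N_ind i).
  exact: (arrow_closed_hom0 f Jup Ji nJj).
apply/negP/negP/contraT => nJi; have [_ [Nn0 _]] := N_ind i.
by case: Nn0; apply/is_zeroP=> x; rewrite -(homA_idE x) Ni0.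
Qed.

Lemma hom_orthogonal_splitting J :
  up_closed arrow J -> splitting_torsion_class d C (hom_orthogonal J).
Proof.
move=> Jup; apply: orthogonal_splitting => //.
- exact: hom_orthogonal_additive.
- by move=> X [].
move=> W X g [_ W0] CX Xind nX w; have [i Xi] := N_all CX Xind.
have nJi : i \notin J.
  apply/negP=> /(hom_orthogonal_index _ Jup) Ni; apply: nX.
  exact: additive_iso (hom_orthogonal_additive J) (isomorphic_sym Xi) Ni.
have [f [f' [fK _]]] := (isomorphicP _ _).1 Xi.
by rewrite -(fK (g w)) -(compAE f g) (W0 i) // linear0.
Qed.

Lemma splitting_up_closed T :
  splitting_torsion_class d C T -> up_closed arrow (index_set T).
Proof.
move=> Tsplit i j /in_index_set Ti /asboolP[f [_ [x fx]]].
apply/in_index_set; apply: contrapT => nTj; apply: fx; have [CNj Nj] := N_ind j.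
exact: (splitting_orthogonal f d_gt0 C_acyclic Tsplit Ti CNj Nj nTj).
Qed.

(** Both sides are additive with the same index set. Equality of predicates is wanted because
    [spine] asks for equality with a member of the chain. *)
Lemma splitting_hom_orthogonal T :
  splitting_torsion_class d C T -> hom_orthogonal (index_set T) = T.
Proof.
move=> Tsplit; have Tup := splitting_up_closed Tsplit; have [[Tadd TC _] _] := Tsplit.
apply/funext=> X; apply/propext; split; apply: additive_sub_index => //.
- exact: hom_orthogonal_additive.
- by move=> Y [].
- by move=> i /(hom_orthogonal_index _ Tup)/in_index_set.
- exact: hom_orthogonal_additive.
- by move=> i /in_index_set/(hom_orthogonal_index _ Tup).
Qed.

Lemma splitting_chain T : splitting_torsion_class d C T ->
  exists x, is_chain (torsion_class d C) #|I| x /\ x #|index_set T| = T.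
Proof.
move=> Tsplit.
have [x [xT xup xlt]] :=
  up_closed_maximal_chain arrow_acyclic (splitting_up_closed Tsplit).
exists (fun i => hom_orthogonal (x i)).
split; last by rewrite xT splitting_hom_orthogonal.
split=> i lei; first by case: (hom_orthogonal_splitting (xup i)).
have /properP[/subsetP sub [j jS nj]] := xlt i lei; split=> [X [CX X0]|sub'].
  by split=> // l f nl; apply: X0; apply: contra nl => /sub.
by move/negP: nj; apply; apply/hom_orthogonal_index/sub'/hom_orthogonal_index.
Qed.

(** * Chains of torsion classes and their lengths *)

Section Chain.
Variables (m : nat) (x : nat -> modA -> Prop).
Hypothesis x_chain : is_chain (torsion_class d C) m x.

Lemma chain_index_proper i :
  (i < m)%N -> index_set (x i) \proper index_set (x i.+1).
Proof.
case: x_chain => x_tors x_lt ltim.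
have [xi_add _ _] := x_tors i (ltnW ltim); have [xSi_add xSiC _] := x_tors i.+1 ltim.
exact: index_set_proper (x_lt i ltim).
Qed.

(** Each strict inclusion adds at least one indecomposable. *)
Lemma chain_card_index i j : (i <= j <= m)%N ->
  (#|index_set (x i)| + (j - i) <= #|index_set (x j)|)%N.
Proof.
elim: j => [|j IHj]; first by rewrite leqn0 => /andP[/eqP-> _]; rewrite addn0.
case/andP; rewrite leq_eqVlt => /predU1P[->|ltij] ltjm; first by rewrite subnn addn0.
rewrite subSn // addnS; apply: leq_ltn_trans (IHj _) _.
  by rewrite [(i <= j)%N]ltij ltnW.
exact/proper_card/chain_index_proper.
Qed.

Lemma chain_length : (m <= #|I|)%N.
Proof.
have := @chain_card_index 0 m; rewrite leqnn subn0 => /(_ isT) le.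
exact: leq_trans (leq_trans (leq_addl _ _) le) (max_card _).
Qed.

Lemma chain_incl i j : (i <= j <= m)%N -> forall X, x i X -> x j X.
Proof.
elim: j => [|j IHj]; first by rewrite leqn0 => /andP[/eqP-> _].
case/andP; rewrite leq_eqVlt => /predU1P[->//|ltij] ltjm X xiX.
have [_ /(_ j ltjm)[sub _]] := x_chain.
by apply: sub; apply: IHj xiX; rewrite [(i <= j)%N]ltij ltnW.
Qed.

Lemma maximal_chain_splitting i :
  m = #|I| -> (i <= m)%N -> splitting_torsion_class d C (x i).
Proof.
move=> mI leim; have [x_tors x_lt] := x_chain.
(* A chain of length [#|I|] leaves no slack: every step adds exactly one indecomposable. *)
have card_x j : (j <= m)%N -> #|index_set (x j)| = j.
  move=> lejm; apply/eqP; rewrite eqn_leq.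
  have := @chain_card_index 0 j; rewrite lejm subn0 => /(_ isT) lej.
  rewrite (leq_trans (leq_addl _ _) lej) andbT.
  have := @chain_card_index j m; rewrite lejm leqnn => /(_ isT) lem.
  rewrite -(leq_add2r (m - j)) subnKC // (leq_trans lem) //.
  by rewrite mI max_card.
have [xi_add xiC _] := x_tors i leim.
apply: orthogonal_splitting => // W X g xiW CX Xind nxiX.
have [p Xp] := N_all CX Xind.
have x_index s Z : isomorphic Z (N s) ->
    forall j, (j <= m)%N -> x j Z <-> s \in index_set (x j).
  move=> Zs j /x_tors[xj_add _ _]; split=> [xjZ|/in_index_set xjs].
    exact/in_index_set/(additive_iso xj_add Zs).
  exact: additive_iso xj_add (isomorphic_sym Zs) xjs.
have xmX : x m X.
  apply/(x_index p X Xp) => //; suff -> : index_set (x m) = setT by rewrite inE.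
  by apply/eqP; rewrite eqEcard subsetT cardsT card_x ?mI /=.
(* Let [X] first appear at stage [j], necessarily after [i]. It is the only new indecomposable
   there, so it is orthogonal to the preceding class, which contains [x i]. *)
have [|j /asboolP xjX j_min] := @ex_minnP (fun j => `[< x j X >]).
  by exists m; apply/asboolP.
have lejm : (j <= m)%N by apply/j_min/asboolP.
have ltij : (i < j)%N.
  rewrite ltnNge; apply/negP => leji; apply: nxiX.
  by apply: chain_incl xjX; rewrite leji.
case: j => // j in xjX j_min lejm ltij *; have lejm' := ltnW lejm.
have nxjX : ~ x j X by move=> /asboolP/j_min; rewrite ltnn.
apply: (torsion_cover_orthogonal d_gt0 C_acyclic (x_tors j lejm') (x_tors j.+1 lejm)
          xjX Xind nxjX); last by apply: chain_incl xiW; rewrite lejm' andbT.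
move=> Y xSjY Yind nxjY; have [xSj_add xSjC _] := x_tors j.+1 lejm.
have [q Yq] := N_all (xSjC Y xSjY) Yind.
have /cards1P[r Dr] : #|index_set (x j.+1) :\: index_set (x j)| == 1%N.
  rewrite cardsD (setIidPr (proper_sub (chain_index_proper lejm))).
  by rewrite !card_x // subSnn.
have new s Z : isomorphic Z (N s) -> x j.+1 Z -> ~ x j Z -> s = r.
  move=> Zs xSjZ nxjZ; apply/set1P; rewrite -Dr inE.
  apply/andP; split; last exact/(x_index s Z Zs).
  by apply/negP=> /(x_index s Z Zs _ lejm').
have qp : q = p by rewrite (new q Y) // (new p X).
by apply: (isomorphic_trans Yq); rewrite qp; apply: isomorphic_sym.
Qed.

End Chain.

End Classification.

Theorem theoremB (k : closedFieldType) (d : nat) (A : falgType k)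
    (C : fdmod A -> Prop) :
  (1 <= d)%N ->
  cluster_tilting d C ->
  ~ has_cycle C ->
  finitely_many_indecomposables C ->
  forall U : fdmod A -> Prop,
    spine (torsion_class d C) U <-> splitting_torsion_class d C U.
Proof.
move=> d_gt0 [Cadd _ _ _] acyclic fin U.
have [I [N [N_ind N_inj N_all]]] := indecomposable_representatives Cadd fin.
split=> [[m [x [x_chain x_max [i leim <-]]]]|Usplit].
  apply: (maximal_chain_splitting d_gt0 Cadd acyclic N_all x_chain) => //.
  apply/eqP; rewrite eqn_leq (chain_length N_all x_chain).
  (* Any splitting class provides a chain of length [#|I|] to compare with; the one of the empty
     up-set is used. *)
  have up0 : up_closed (arrow N) set0 by move=> p q; rewrite inE.
  have [y [y_chain _]] := splitting_chain d_gt0 Cadd acyclic N_ind N_inj N_all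
    (hom_orthogonal_splitting d_gt0 Cadd N_ind N_inj N_all up0).
  exact: x_max y_chain.
have [x [x_chain xU]] := splitting_chain d_gt0 Cadd acyclic N_ind N_inj N_all Usplit.
exists #|I|, x; split=> //.
  by move=> m' x'; apply: (chain_length N_all).
exists #|index_set N U| => //; exact: max_card.
Qed.
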